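(* Let $R$ be a 2-primal ring and let $\alpha$ be an endomorphism of $R$ such that $R$ is $\alpha$-compatible. The following are equivalent: (1) $R[x;\alpha]$ is a 2-$\Delta U$ ring. (2) $R$ is a 2-$\Delta U$ ring.
   Context: Rings are associative with identity, not necessarily commutative. $U(R)$ is the group of units of $R$. $\Delta(R)=\{r\in R : r+U(R)\subseteq U(R)\}$. A ring $R$ is called 2-$\Delta U$ if $u^2\in 1+\Delta(R)$ for every $u\in U(R)$. $R$ is 2-primal if its prime radical $\mathrm{Nil}_*(R)$ (the intersection of all prime ideals) equals the set of all nilpotent elements of $R$. For a ring endomorphism $\alpha$ of $R$, $R$ is $\alpha$-compatible if for all $a,b\in R$: $ab=0\iff a\alpha(b)=0$. $R[x;\alpha]$ is the skew polynomial ring over $R$ (coefficients written on the left), with multiplication determined by $xr=\alpha(r)x$ for $r\in R$. *)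

(* Defs.v *)
From HB Require Import structures.
From mathcomp Require Import all_boot all_order all_algebra finmap.
From mathcomp.multinomials Require Import monalg.

Set Implicit Arguments.
Unset Strict Implicit.
Unset Printing Implicit Defensive.

Import GRing.Theory.
Local Open Scope ring_scope.

Section RingNotions.
Variable S : pzRingType.

Definition is_unit (u : S) : Prop := exists v, u * v = 1 /\ v * u = 1.

Definition in_Delta (r : S) : Prop := forall u, is_unit u -> is_unit (r + u).

Definition two_DeltaU : Prop :=
  forall u, is_unit u -> exists d, in_Delta d /\ u ^+ 2 = 1 + d.

Definition nilpotent (a : S) : Prop := exists n, a ^+ n = 0.

Definition two_sided_ideal (I : S -> Prop) : Prop :=
  [/\ I 0,
      (forall a b, I a -> I b -> I (a - b))
    & (forall r a, I a -> I (r * a) /\ I (a * r))].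

(* the additive span of the products of an element of I and an element of J *)
Definition ideal_mul (I J : S -> Prop) (x : S) : Prop :=
  exists n (a b : 'I_n -> S),
    (forall i, I (a i) /\ J (b i)) /\ x = \sum_(i < n) a i * b i.

(* primeness in the noncommutative sense, i.e. tested on products of ideals *)
Definition prime_ideal (P : S -> Prop) : Prop :=
  [/\ two_sided_ideal P,
      (exists x, ~ P x)
    & forall I J, two_sided_ideal I -> two_sided_ideal J ->
        (forall x, ideal_mul I J x -> P x) ->
        (forall x, I x -> P x) \/ (forall x, J x -> P x)].

Definition prime_radical (x : S) : Prop := forall P, prime_ideal P -> P x.

Definition two_primal : Prop := forall x, prime_radical x <-> nilpotent x.

End RingNotions.

Definition compatible (R : pzRingType) (alpha : {rmorphism R -> R}) : Prop :=
  forall a b : R, a * b = 0 <-> a * alpha b = 0.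

(* An element of {malg R[nat]} is a finitely supported family of coefficients *)
(* p@_i, read here as the sum of the p@_i x^i; << c *g i >> is the monomial   *)
(* c x^i.  Unlike {poly R}, this makes sense over the zero ring.  The product *)
(* is the bilinear extension of (a x^i) (b x^j) = a alpha^i(b) x^(i + j).     *)
Definition skew_poly (R : pzRingType) (alpha : {rmorphism R -> R}) : Type :=
  {malg R[nat]}.

Section SkewPoly.
Variables (R : pzRingType) (alpha : {rmorphism R -> R}).

HB.instance Definition _ := GRing.Zmodule.on (skew_poly alpha).

Local Notation T := {malg R[nat]}.
Implicit Types (p q r : T) (i j k : nat) (a b c : R).

Definition skew_one : T := << 1 *g 0%N >>.

Definition skew_mul p q : T :=
  \sum_(i <- msupp p) \sum_(j <- msupp q)
     << p@_i * iter i alpha q@_j *g (i + j)%N >>.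

Lemma iter_alpha0 i : iter i alpha 0 = 0.
Proof. by elim: i => //= i ->; rewrite rmorph0. Qed.

Lemma iter_alpha1 i : iter i alpha 1 = 1.
Proof. by elim: i => //= i ->; rewrite rmorph1. Qed.

Lemma iter_alphaD i : {morph iter i alpha : a b / a + b}.
Proof. by move=> a b; elim: i => //= i ->; rewrite rmorphD. Qed.

Lemma iter_alphaM i : {morph iter i alpha : a b / a * b}.
Proof. by move=> a b; elim: i => //= i ->; rewrite rmorphM. Qed.

Lemma skew_mulEw (d1 d2 : {fset nat}) p q :
    (msupp p `<=` d1)%fset -> (msupp q `<=` d2)%fset ->
  skew_mul p q =
    \sum_(i <- d1) \sum_(j <- d2) << p@_i * iter i alpha q@_j *g (i + j)%N >>.
Proof.
move=> s1 s2; rewrite /skew_mul (big_fset_incl _ s1) /=; last first.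
  move=> i _ /mcoeff_outdom ->.
  by rewrite big1 // => j _; rewrite mul0r monalgU0.
apply: eq_bigr => i _; apply: big_fset_incl => //.
by move=> j _ /mcoeff_outdom ->; rewrite iter_alpha0 mulr0 monalgU0.
Qed.

Lemma skew_mulDl : left_distributive skew_mul +%R.
Proof.
move=> p q r.
have s1 : (msupp p `<=` msupp p `|` msupp q)%fset by apply: fsubsetUl.
have s2 : (msupp q `<=` msupp p `|` msupp q)%fset by apply: fsubsetUr.
rewrite (skew_mulEw (msuppD_le p q) (fsubset_refl _)).
rewrite (skew_mulEw s1 (fsubset_refl _)) (skew_mulEw s2 (fsubset_refl _)).
rewrite -big_split; apply: eq_bigr => i _ /=.
rewrite -big_split; apply: eq_bigr => j _ /=.
by rewrite mcoeffD mulrDl monalgUD.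
Qed.

Lemma skew_mulDr : right_distributive skew_mul +%R.
Proof.
move=> r p q.
have s1 : (msupp p `<=` msupp p `|` msupp q)%fset by apply: fsubsetUl.
have s2 : (msupp q `<=` msupp p `|` msupp q)%fset by apply: fsubsetUr.
rewrite (skew_mulEw (fsubset_refl _) (msuppD_le p q)).
rewrite (skew_mulEw (fsubset_refl _) s1) (skew_mulEw (fsubset_refl _) s2).
rewrite -big_split; apply: eq_bigr => i _ /=.
rewrite -big_split; apply: eq_bigr => j _ /=.
by rewrite mcoeffD iter_alphaD mulrDr monalgUD.
Qed.

Lemma skew_mul0l : left_zero 0 skew_mul.
Proof. by move=> p; rewrite /skew_mul msupp0 big_seq_fset0. Qed.

Lemma skew_mul0r : right_zero 0 skew_mul.
Proof.
by move=> p; rewrite /skew_mul big1 // => i _; rewrite msupp0 big_seq_fset0.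
Qed.

Lemma skew_mul_suml (I : Type) (s : seq I) (F : I -> T) q :
  skew_mul (\sum_(i <- s) F i) q = \sum_(i <- s) skew_mul (F i) q.
Proof.
elim: s => [|i s IHs]; first by rewrite !big_nil skew_mul0l.
by rewrite !big_cons skew_mulDl IHs.
Qed.

Lemma skew_mul_sumr (I : Type) (s : seq I) (F : I -> T) q :
  skew_mul q (\sum_(i <- s) F i) = \sum_(i <- s) skew_mul q (F i).
Proof.
elim: s => [|i s IHs]; first by rewrite !big_nil skew_mul0r.
by rewrite !big_cons skew_mulDr IHs.
Qed.

Lemma skew_mulUU a b i j :
  skew_mul << a *g i >> << b *g j >> = << a * iter i alpha b *g (i + j)%N >>.
Proof.
by rewrite (skew_mulEw msuppU_le msuppU_le) !big_seq_fset1 !mcoeffUU.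
Qed.

Lemma skew_ind (P : T -> Prop) :
    P 0 -> (forall p q, P p -> P q -> P (p + q)) ->
    (forall a i, P << a *g i >>) ->
  forall p, P p.
Proof. by move=> P0 PD PU p; rewrite [p]monalgE; elim/big_ind: _. Qed.

Lemma skew_mulA : associative skew_mul.
Proof.
move=> p q r; elim/skew_ind: p; first by rewrite !skew_mul0l.
  by move=> p p' IH IH'; rewrite !skew_mulDl IH IH'.
move=> a i; elim/skew_ind: q; first by rewrite !(skew_mul0l, skew_mul0r).
  by move=> q q' IH IH'; rewrite !(skew_mulDl, skew_mulDr) IH IH'.
move=> b j; elim/skew_ind: r; first by rewrite !skew_mul0r.
  by move=> r r' IH IH'; rewrite !skew_mulDr IH IH'.
by move=> c k; rewrite !skew_mulUU iter_alphaM -iterD mulrA addnA.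
Qed.

Lemma skew_mul1l : left_id skew_one skew_mul.
Proof.
move=> p; elim/skew_ind: p; first by rewrite skew_mul0r.
  by move=> p q IHp IHq; rewrite skew_mulDr IHp IHq.
by move=> a i; rewrite skew_mulUU mul1r add0n.
Qed.

Lemma skew_mul1r : right_id skew_one skew_mul.
Proof.
move=> p; elim/skew_ind: p; first by rewrite skew_mul0l.
  by move=> p q IHp IHq; rewrite skew_mulDl IHp IHq.
by move=> a i; rewrite skew_mulUU iter_alpha1 mulr1 addn0.
Qed.

HB.instance Definition _ := GRing.Zmodule_isPzRing.Build (skew_poly alpha)
  skew_mulA skew_mul1l skew_mul1r skew_mulDl skew_mulDr.

Definition skewC (c : R) : skew_poly alpha := << c *g 0%N >>.
Definition skewX : skew_poly alpha := << 1 *g 1%N >>.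

Lemma skewX_mulC (c : R) : skewX * skewC c = skewC (alpha c) * skewX.
Proof. by rewrite /GRing.mul /= !skew_mulUU /= mul1r mulr1. Qed.

Lemma skewXn n : skewX ^+ n = << 1 *g n >> :> T.
Proof.
elim: n => [|n IHn]; first by rewrite expr0.
rewrite exprS; move: IHn; rewrite /GRing.mul /= => ->.
by rewrite skew_mulUU iter_alpha1 mulr1 add1n.
Qed.

Lemma skew_polyE (p : skew_poly alpha) :
  p = \sum_(i <- msupp (p : T)) skewC (p : T)@_i * skewX ^+ i.
Proof.
rewrite [LHS](monalgE (p : T)); apply: eq_bigr => i _.
by rewrite skewXn /GRing.mul /= skew_mulUU /= mulr1 add0n.
Qed.

End SkewPoly.

(* Main.v *)
(** The nilpotent elements of a 2-primal ring form an ideal [N], and [R / N] is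
reduced.  An Armendariz argument modulo [N] shows that every unit of
[R[x; alpha]] has a unit as constant term and all its other coefficients in [N].
Conversely the prime radical is locally nilpotent, so by compatibility a skew
polynomial with coefficients in [N] is nilpotent, and every skew polynomial of
the previous shape is a unit.  Hence [f] with its nonconstant coefficients in
[N] lies in [Delta(R[x; alpha])] as soon as its constant term lies in
[Delta(R)], and both implications follow by looking at constant terms. *)

Require Import Defs.
From mathcomp Require Import all_boot all_order all_algebra finmap.
From mathcomp.multinomials Require Import monalg.
From mathcomp Require Import boolp classical_sets.

Set Implicit Arguments.
Unset Strict Implicit.
Unset Printing Implicit Defensive.

Import GRing.Theory.
Local Open Scope ring_scope.

(** * Two-sided ideals and their sums *)

Section Ideals.
Variable S : pzRingType.
Implicit Types (a b x y : S) (I J P : S -> Prop).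

Lemma idealN I a : two_sided_ideal I -> I a -> I (- a).
Proof. by case=> I0 IB _ Ia; rewrite -sub0r; apply: IB. Qed.

Lemma idealD I a b : two_sided_ideal I -> I a -> I b -> I (a + b).
Proof.
move=> hI Ia Ib; rewrite -[b]opprK; case: (hI) => _ IB _.
by apply: IB => //; apply: idealN.
Qed.

Lemma idealMl I a b : two_sided_ideal I -> I b -> I (a * b).
Proof. by case=> _ _ IM /(IM a)[]. Qed.

Lemma idealMr I a b : two_sided_ideal I -> I a -> I (a * b).
Proof. by case=> _ _ IM /(IM b)[]. Qed.

Lemma ideal_sum I (T : Type) (s : seq T) (Q : pred T) (F : T -> S) :
  two_sided_ideal I -> (forall i, Q i -> I (F i)) -> I (\sum_(i <- s | Q i) F i).
Proof.
move=> hI IF; elim/big_ind: _ => //; first by case: hI.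
by move=> a b; apply: idealD.
Qed.

Lemma ideal_zero : two_sided_ideal (fun x => x = 0).
Proof.
split=> // [a b -> ->|r a ->]; first by rewrite subr0.
by rewrite mulr0 mul0r.
Qed.

Lemma ideal_add I J : two_sided_ideal I -> two_sided_ideal J ->
  two_sided_ideal (fun x => exists a b, [/\ I a, J b & x = a + b]).
Proof.
move=> hI hJ; split.
- by exists 0, 0; rewrite addr0; case: hI; case: hJ.
- move=> _ _ [a [b [Ia Jb ->]]] [a' [b' [Ia' Jb' ->]]].
  exists (a - a'), (b - b'); rewrite opprD addrACA.
  by split=> //; [case: hI => _ + _; apply | case: hJ => _ + _; apply].
- move=> r _ [a [b [Ia Jb ->]]]; split.
    by exists (r * a), (r * b); rewrite mulrDr; split=> //; apply: idealMl.
  by exists (a * r), (b * r); rewrite mulrDl; split=> //; apply: idealMr.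
Qed.

Lemma ideal_prime_radical : two_sided_ideal (@prime_radical S).
Proof.
split=> [P [[]]|a b Na Nb P hP|r a Na] //.
  by case: (hP) => -[_ IB _] _ _; apply: IB; [apply: Na | apply: Nb].
by split=> P hP; case: (hP) => hI _ _; [apply: idealMl | apply: idealMr] => //;
  apply: Na.
Qed.

(** * Local nilpotence of the prime radical *)

Fixpoint words (F : seq S) n : seq S :=
  if n is m.+1 then [seq a * w | a <- F, w <- words F m] else [:: 1].

Lemma words_add F m n w : w \in words F (m + n) ->
  exists u v, [/\ u \in words F m, v \in words F n & w = u * v].
Proof.
elim: m w => [|m IH] w /=; first by exists 1, w; rewrite mem_head mul1r.
case/allpairsP=> -[a w'] /= [aF /IH[u [v [um vn ->]]] ->].
by exists (a * u), v; split=> //; [apply: allpairs_f | rewrite mulrA].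
Qed.

(** For an ideal [I]: the image of [F] in the quotient does not generate a nilpotent subring. *)
Definition big_modulo F I := forall n, exists2 w, w \in words F n & ~ I w.

(** Zorn's lemma, which applies because each length has only finitely many words. *)
Lemma maximal_big_ideal F : big_modulo F (fun x => x = 0) ->
  exists P, [/\ two_sided_ideal P, big_modulo F P
    & forall J, two_sided_ideal J -> (forall x, P x -> J x) ->
      big_modulo F J -> forall x, J x -> P x].
Proof.
move=> big0.
(* Adjoining [0] makes the union of the empty chain admissible. *)
pose Q (X : set S) : S -> Prop := fun x => x = 0 \/ X x.
pose good : set (set S) := fun X => two_sided_ideal (Q X) /\ big_modulo F (Q X).
have Qideal X I : two_sided_ideal I -> (forall x, Q X x <-> I x) ->
    two_sided_ideal (Q X).
  move=> hI e; split; first by left.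
    by move=> a b /e Ia /e Ib; apply/e; case: hI => _ + _; apply.
  by move=> r a /e Ia; split; apply/e; [apply: idealMl | apply: idealMr].
have [|A [[A1 A2] Amax]] := @Zorn_bigcup S good.
  move=> C Cgood Ctot; have [[X0 CX0]|C0] := pselect (exists X, C X); last first.
    have e x : Q (\bigcup_(X in C) X)%classic x <-> x = 0.
      split; last by left.
      by case=> // -[X CX _]; case: C0; exists X.
    split; first exact: Qideal ideal_zero e.
    by move=> n; have [w ? nw] := big0 n; exists w => // /e.
  have inQ x : Q (\bigcup_(X in C) X)%classic x -> exists2 X, C X & Q X x.
    by case=> [->|[X CX Xx]]; [exists X0 => //; left | exists X => //; right].
  have Qin X x : C X -> Q X x -> Q (\bigcup_(X in C) X)%classic x.
    by move=> CX [->|Xx]; [left | right; exists X].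
  have join X Y : C X -> C Y -> exists2 Z, C Z &
      (forall x, Q X x -> Q Z x) /\ (forall x, Q Y x -> Q Z x).
    by move=> CX CY; have [s|s] := Ctot _ _ CX CY;
      [exists Y | exists X] => //; split=> // x [->|/s]; by [left | right].
  split.
    split; first by left.
      move=> a b /inQ[X CX Xa] /inQ[Y CY Yb]; have [Z CZ [sX sY]] := join _ _ CX CY.
      have [[_ ZB _] _] := Cgood _ CZ.
      by apply: (Qin Z) => //; apply: ZB; [apply: sX | apply: sY].
    move=> r a /inQ[X CX Xa]; have [hX _] := Cgood _ CX.
    by split; apply: (Qin X) => //; [apply: idealMl | apply: idealMr].
  move=> n; apply: contrapT => now.
  have allw w : w \in words F n -> Q (\bigcup_(X in C) X)%classic w.
    by move=> wn; apply: contrapT => nw; apply: now; exists w.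
  (* The list [words F n] is finite and the chain is total, so a single member already contains all
     these words. *)
  have [X CX Xw] : exists2 X, C X & forall w, w \in words F n -> Q X w.
    elim: (words F n) allw => [|w s IH] allw; first by exists X0.
    have [|X CX Xs] := IH; first by move=> v vs; apply: allw; rewrite inE vs orbT.
    have [Y CY Yw] := inQ _ (allw w (mem_head _ _)).
    have [Z CZ [sX sY]] := join _ _ CX CY; exists Z => // v.
    by rewrite inE => /predU1P[->|/Xs]; [apply: sY | apply: sX].
  by have [_ /(_ n)[w /Xw]] := Cgood _ CX.
exists (Q A); split=> // J hJ AJ bigJ x Jx; apply: contrapT => nAx.
have J0 : J 0 by case: hJ.
have e y : Q J y <-> J y by split; [case=> // -> | right].
apply: (Amax J); last first.
  split; first exact: Qideal hJ e.
  by move=> n; have [w ? nw] := bigJ n; exists w => // /e.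
split=> [y Ay|sJA]; first by apply: AJ; right.
by apply: nAx; right; apply: sJA.
Qed.

(** If neither [I] nor [J] lies in [P], maximality makes [P + I] and [P + J] swallow all words of
    some lengths [m] and [n]. Words of length [m + n] then lie in [(P + I)(P + J)], hence in [P], a
    contradiction. *)
Lemma big_ideal_prime F P : two_sided_ideal P -> big_modulo F P ->
  (forall J, two_sided_ideal J -> (forall x, P x -> J x) ->
     big_modulo F J -> forall x, J x -> P x) ->
  prime_ideal P.
Proof.
move=> hP bigP Pmax; split=> //; first by have [w _] := bigP 0%N; exists w.
move=> I J hI hJ IJ; apply: contrapT => /not_orP[nI nJ].
have small K : two_sided_ideal K -> ~ (forall x, K x -> P x) ->
    exists n, forall w, w \in words F n -> exists a b, [/\ P a, K b & w = a + b].
  move=> hK nK; apply: contrapT => big; apply: nK => x Kx.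
  apply: Pmax (ideal_add hP hK) _ _ _ _.
  - by move=> y Py; exists y, 0; rewrite addr0; split=> //; case: hK.
  - move=> n; apply: contrapT => now; apply: big; exists n => w wn.
    by apply: contrapT => nw; apply: now; exists w.
  - by exists 0, x; rewrite add0r; split=> //; case: hP.
have [m mI] := small I hI nI; have [n nJ'] := small J hJ nJ.
have [w /words_add[u [v [/mI[p [a [Pp Ia ->]]] /nJ'[q [b [Pq Jb ->]]] ->]]]] :=
  bigP (m + n)%N.
apply; rewrite mulrDl; apply: (idealD hP); first exact: idealMr.
rewrite mulrDr; apply: (idealD hP); first exact: idealMl.
by apply: IJ; exists 1%N, (fun=> a), (fun=> b); rewrite big_ord1.
Qed.

(** Otherwise some prime ideal avoids a word of every length; but it contains [F], hence every word
    of length 1. *)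
Lemma prime_radical_locally_nilpotent F : (forall a, a \in F -> prime_radical a) ->
  exists n, forall w, w \in words F n -> w = 0.
Proof.
move=> FN; apply: contrapT => nF.
have big0 : big_modulo F (fun x => x = 0).
  move=> n; apply: contrapT => now; apply: nF; exists n => w wn.
  by apply: contrapT => nw; apply: now; exists w.
have [P [hP bigP Pmax]] := maximal_big_ideal big0.
have primeP := big_ideal_prime hP bigP Pmax.
have [w] := bigP 1%N; case/allpairsP=> -[a v] /= [aF _ ->]; apply.
by apply: idealMr => //; apply: FN.
Qed.

Lemma unit_nilpotent1D x : nilpotent x -> is_unit (1 + x).
Proof.
case=> n xn0; exists (\sum_(i < n) (- x) ^+ i).
have e : (1 + x) = - (- x - 1) by rewrite opprB opprK.
have nx : (- x) ^+ n = 0 by rewrite exprNn xn0 mulr0.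
have c : (- x - 1) * (\sum_(i < n) (- x) ^+ i) = (\sum_(i < n) (- x) ^+ i) * (- x - 1).
  apply: commr_sum => i _; apply/commr_sym/commrB; last exact: commr1.
  exact/commr_sym/commrX.
by rewrite e mulNr mulrN -c -subrX1 nx sub0r opprK.
Qed.

Lemma unitM a b : is_unit a -> is_unit b -> is_unit (a * b).
Proof.
case=> a' [aa' a'a] [b' [bb' b'b]]; exists (b' * a').
by rewrite mulrA -(mulrA a) bb' mulr1 aa' mulrA -(mulrA b') a'a mulr1 b'b.
Qed.

End Ideals.

(** * Rings whose nilpotent elements form an ideal *)

Section NilpotentIdeal.
Variable R : pzRingType.
Hypothesis nil_ideal : two_sided_ideal (@nilpotent R).
Implicit Types a b x y : R.

Lemma nilpotent_sqr a : nilpotent (a * a) -> nilpotent a.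
Proof. by case=> n; rewrite -expr2 -exprM => ?; exists (2 * n)%N. Qed.

Lemma nilpotent_mulC a b : nilpotent (a * b) -> nilpotent (b * a).
Proof.
move=> Nab; apply: nilpotent_sqr; rewrite mulrA -(mulrA b).
by apply: idealMr => //; apply: idealMl.
Qed.

End NilpotentIdeal.

(** * Inserting powers of [alpha] into products *)

Section Compatible.
Variables (R : pzRingType) (alpha : {rmorphism R -> R}).
Hypothesis compat : compatible alpha.
Implicit Types a b x y : R.

(** Compatibility first applies [alpha] to [y] as well, then removes it from the whole product
    [b * y]. *)
Lemma compatible_iter i x a y : x * a * y = 0 <-> x * iter i alpha a * y = 0.
Proof.
elim: i => //= i ->; move: (iter i alpha a) => b.
by rewrite (compat (x * alpha b)) -!mulrA -rmorphM -compat.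
Qed.

(** The prefix [x] is there for the induction: it absorbs the first factor of the power. *)
Lemma compatible_expr i n x a b :
  x * (a * b) ^+ n = 0 <-> x * (a * iter i alpha b) ^+ n = 0.
Proof.
elim: n x => [|n IH] x; first by rewrite !expr0.
rewrite !exprS !mulrA -IH -[x * a * b * _]mulrA.
rewrite -[x * a * iter i alpha b * _]mulrA !mulrA.
exact: compatible_iter.
Qed.

Lemma compatible_nilpotent i a b :
  nilpotent (a * b) <-> nilpotent (a * iter i alpha b).
Proof.
by split=> -[n e]; exists n; rewrite -[LHS]mul1r;
  [apply: (compatible_expr i n 1 a b).1 | apply: (compatible_expr i n 1 a b).2];
  rewrite mul1r.
Qed.

End Compatible.

(** * Coefficients of skew products *)

Section SkewPolyUnits.
Variables (R : pzRingType) (alpha : {rmorphism R -> R}).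
Local Notation SP := (skew_poly alpha).
Local Notation coef p k := ((p : {malg R[nat]})@_(k : nat)).
Implicit Types (f g p q : SP) (a b : R) (i j k n : nat).

(** Both sides are biadditive, so monomials suffice; there only the index [i] can contribute to the
    sum. *)
Lemma skew_coefM p q k : coef (p * q) k =
  \sum_(i < k.+1) coef p i * iter i alpha (coef q (k - i)).
Proof.
rewrite -[p * q]/(skew_mul alpha p q); elim/skew_ind: p => [|p p' IH IH'|a i].
- by rewrite skew_mul0l mcoeff0 big1 // => l _; rewrite mcoeff0 mul0r.
- rewrite skew_mulDl mcoeffD IH IH' -big_split /=.
  by apply: eq_bigr => l _; rewrite mcoeffD mulrDl.
elim/skew_ind: q => [|q q' IH IH'|b j].
- by rewrite skew_mul0r mcoeff0 big1 // => l _; rewrite mcoeff0 iter_alpha0 mulr0.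
- rewrite skew_mulDr mcoeffD IH IH' -big_split /=.
  by apply: eq_bigr => l _; rewrite mcoeffD iter_alphaD mulrDr.
rewrite skew_mulUU mcoeffU.
have [ik|ki] := leqP i k; last first.
  rewrite big1 => [|l _]; first by case: eqP => // e; rewrite -e ltnNge leq_addr in ki.
  rewrite mcoeffU; case: eqP => [e|]; last by rewrite mulr0n mul0r.
  by move: (ltn_ord l); rewrite -e ltnS leqNgt ki.
rewrite (bigD1 (Ordinal (ik : (i < k.+1)%N))) //= big1 ?addr0 => [|l li]; last first.
  rewrite mcoeffU; case: eqP => [e|]; last by rewrite mulr0n mul0r.
  by case/eqP: li; apply: val_inj.
rewrite !mcoeffU eqxx mulr1n -(eqn_add2l i j) subnKC //.
by case: eqP; rewrite ?mulr1n ?mulr0n ?iter_alpha0 ?mulr0.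
Qed.

Lemma skew_coef1 k : coef (1 : SP) k = (k == 0%N)%:R.
Proof. by rewrite -[1]/(skew_one R) mcoeffU eq_sym. Qed.

Lemma skew_coefC a k : coef (skewC alpha a) k = a *+ (k == 0%N).
Proof. by rewrite mcoeffU eq_sym. Qed.

Lemma skew_coef0M p q : coef (p * q) 0 = coef p 0 * coef q 0.
Proof. by rewrite skew_coefM big_ord1. Qed.

Lemma skew_coefCM a p k : coef (skewC alpha a * p) k = a * coef p k.
Proof.
rewrite skew_coefM big_ord_recl skew_coefC /= subn0 mulr1n big1 ?addr0 // => i _.
by rewrite skew_coefC /= mulr0n mul0r.
Qed.

Lemma skew_coef_bound f : exists d, forall k, (d <= k)%N -> coef f k = 0.
Proof.
exists (\max_(i <- msupp (f : {malg R[nat]})) i).+1 => k dk.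
apply: mcoeff_outdom; apply/negP => kf; move: dk.
by rewrite ltnNge (leq_bigmax_seq (F := id)).
Qed.

Lemma skewC_unit a : is_unit a -> is_unit (skewC alpha a).
Proof.
case=> b [ab ba]; exists (skewC alpha b).
by rewrite /GRing.mul /= !skew_mulUU /= ab ba.
Qed.

(** * Nilpotent and invertible skew polynomials *)

Hypotheses (primal : two_primal R) (compat : compatible alpha).

Lemma ideal_nilpotent : two_sided_ideal (@nilpotent R).
Proof.
have [h0 hB hM] := ideal_prime_radical R.
split=> [|a b /primal a0 /primal b0|r a /primal/(hM r)[]].
- exact: (primal 0).1 h0.
- by apply/primal; apply: hB.
- by move=> /primal ? /primal ?.
Qed.

(** Up to twists by [alpha], which compatibility ignores, the coefficients of [f ^+ n] are sums of
    words of length [n] in the coefficients of [f]. *)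
Lemma skew_nilpotent f : (forall k, nilpotent (coef f k)) -> nilpotent f.
Proof.
move=> Nf; pose F := [seq coef f k | k <- msupp (f : {malg R[nat]})].
have [n wn] : exists n, forall w, w \in words F n -> w = 0.
  by apply: prime_radical_locally_nilpotent => _ /mapP[k _ ->]; apply/primal.
exists n.
(* The coefficient [x] in front collects the letters already read, so it only has to kill the words
   still to come. *)
have key m x i : (forall w, w \in words F m -> x * w = 0) ->
    (<< x *g i >> : SP) * f ^+ m = 0.
  elim: m x i => [|m IH] x i xw.
    by rewrite expr0 mulr1 -[x]mulr1 xw ?monalgU0 //= mem_head.
  rewrite exprS mulrA {1}(monalgE (f : {malg R[nat]})) mulr_sumr mulr_suml.
  rewrite big_seq big1 // => j jf.
  rewrite [X in X * _](skew_mulUU alpha); apply: IH => w wm.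
  apply: (compatible_iter compat i x _ w).1; rewrite -mulrA; apply: xw.
  by apply: allpairs_f => //; apply/mapP; exists j.
by rewrite -[f ^+ n]mul1r; apply: key => w /wn ->; rewrite mulr0.
Qed.

(** Descending induction on the degree [i + j], where [e] bounds the gap to [d1 + d2], and within a
    degree ascending induction on [j]. *)
Lemma skew_armendariz f g :
    (forall k, (0 < k)%N -> nilpotent (coef (f * g) k)) ->
  forall i j, (0 < i + j)%N -> nilpotent (coef f i * coef g j).
Proof.
move=> fg; have hN := ideal_nilpotent.
have [d1 fd1] := skew_coef_bound f; have [d2 gd2] := skew_coef_bound g.
suff key e i j : (0 < i + j)%N -> (d1 + d2 <= i + j + e)%N ->
    nilpotent (coef f i * coef g j).
  by move=> i j /(key (d1 + d2)%N); apply; apply: leq_addl.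
elim: e i j => [|e IHe] i j.
  (* In degree at least [d1 + d2], one of the two coefficients is zero. *)
  rewrite addn0 => _ dij; have [/fd1->|id1] := leqP d1 i.
    by rewrite mul0r; case: hN.
  have [/gd2->|jd2] := leqP d2 j; first by rewrite mulr0; case: hN.
  by move: dij; rewrite leqNgt (leq_trans _ (leq_add id1 jd2)) // addSn addnS.
elim/ltn_ind: j i => j IHj i ij dij.
have above l m : (i + j < l + m)%N -> nilpotent (coef f l * coef g m).
  move=> lt; apply: IHe; first exact: leq_ltn_trans lt.
  by rewrite (leq_trans dij) // addnS -addSn leq_add2r.
(* It suffices that [s * coef f i] is nilpotent for the summand [s] of index [i] in the coefficient
   of degree [i + j]: times the twisted [coef g j], it is the square of [s]. *)
apply/(compatible_nilpotent compat i _ _).2/nilpotent_sqr.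
rewrite mulrA; apply: (idealMr _ hN).
have li : (i < (i + j).+1)%N by rewrite ltnS leq_addr.
move: (fg _ ij); rewrite skew_coefM (bigD1 (Ordinal li)) //= addKn.
move=> /(idealMr (coef f i) hN); rewrite mulrDl.
set t := (X in nilpotent (_ + X)) => Nst.
suff Nt : nilpotent t by rewrite -[X in nilpotent X](addrK t); case: hN => _ + _; apply.
rewrite /t mulr_suml; apply: ideal_sum => // l nl.
have lk : (l <= i + j)%N by rewrite -ltnS.
(* For [l < i], moving [coef f i] to the front gives a product of higher degree; for [l > i], the
   index of [g] is below [j]. *)
have [lti|lti|eli] := ltngtP l i; last by case/eqP: nl; apply: val_inj.
  rewrite -mulrA; apply: idealMl => //; apply: (nilpotent_mulC hN).
  apply/(compatible_nilpotent compat l _ _).1/above.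
  by rewrite ltn_add2l ltn_subRL ltn_add2r.
apply: idealMr => //; apply/(compatible_nilpotent compat l _ _).1.
by apply: IHj; rewrite ?subnKC //; rewrite ltn_subLR // ltn_add2r.
Qed.

Lemma skew_unitP f :
  is_unit f <-> is_unit (coef f 0) /\ (forall k, (0 < k)%N -> nilpotent (coef f k)).
Proof.
have hN := ideal_nilpotent.
split=> [[g [fg gf]]|[[b [ab ba]] Nf]].
  have ab : coef f 0 * coef g 0 = 1 by rewrite -skew_coef0M fg skew_coef1.
  have ba : coef g 0 * coef f 0 = 1 by rewrite -skew_coef0M gf skew_coef1.
  split=> [|k k0]; first by exists (coef g 0).
  (* With [g] the inverse, [f_k = (f_k g_0) f_0], and the bracket is nilpotent by the Armendariz
     property. *)
  rewrite -[coef f k]mulr1 -ba mulrA; apply: idealMr => //.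
  apply: skew_armendariz; last by rewrite addn0.
  by move=> l; rewrite fg skew_coef1; case: l => // l _; case: hN.
(* Factoring out the constant term leaves 1 plus a polynomial with nilpotent coefficients. *)
have -> : f = skewC alpha (coef f 0) * (1 + (skewC alpha b * f - 1)).
  apply/malgP => k; rewrite addrCA subrr addr0.
  by rewrite !skew_coefCM mulrA ab mul1r.
apply: unitM; first by apply: skewC_unit; exists b.
apply: unit_nilpotent1D; apply: skew_nilpotent => k.
rewrite mcoeffB skew_coefCM skew_coef1; case: k => [|k].
  by rewrite ba subrr; case: hN.
by rewrite subr0; apply: idealMl => //; apply: Nf.
Qed.

End SkewPolyUnits.

Theorem theorem4p4 (R : pzRingType) (alpha : {rmorphism R -> R}) :
  two_primal R -> compatible alpha ->
  (two_DeltaU (skew_poly alpha) <-> two_DeltaU R).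
Proof.
move=> primal compat; have hN := ideal_nilpotent primal.
have unitP := skew_unitP primal compat.
split=> DU u uu.
  have [d [Dd ed]] := DU _ (skewC_unit alpha uu).
  exists (u ^+ 2 - 1); split; last by rewrite addrC subrK.
  (* A unit [v] of [R] is tested as a constant: the constant term of [d + skewC alpha v] is
     [u ^+ 2 - 1 + v]. *)
  move=> v /(skewC_unit alpha)/Dd/unitP[+ _].
  have -> : d = skewC alpha u ^+ 2 - 1 by rewrite ed addrC addKr.
  by rewrite mcoeffD mcoeffB expr2 skew_coef0M skew_coef1 !skew_coefC !mulr1n.
have /unitP[u0 _] := uu.
(* The square is itself a unit, so its nonconstant coefficients are nilpotent without expanding
   it. *)
have /unitP[_ Nuu] := unitM uu uu.
have [d [Dd ed]] := DU _ u0.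
exists (u ^+ 2 - 1); split; last by rewrite addrC subrK.
move=> v /unitP[v0 Nv]; apply/unitP; rewrite expr2; split=> [|k k0].
  rewrite mcoeffD mcoeffB skew_coef0M skew_coef1 -expr2 ed.
  by rewrite [1 + d]addrC addrK; apply: Dd.
rewrite mcoeffD mcoeffB skew_coef1 (gtn_eqF k0) subr0.
by apply: (idealD hN); [apply: Nuu | apply: Nv].
Qed.
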